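(* Let $R$ be a ring with identity and let $(\Gamma,E,F)$ be a network, i.e. $\Gamma=(A,V,s,t)$ is a directed graph, $E\subseteq V$ is an arbitrary subset, and $F$ is an $R$-representation of $\Gamma$. Then the $R$-module $\Phi(\Gamma,E;F)$ of $1$-chains satisfying the first Kirchhoff law is isomorphic to $$\operatorname{colim}_1^{W(\Gamma\cup_E pt)}\widetilde{(F\oplus_E 0)}.$$
   Context: $\mathrm{Mod}_R$ is the category of left $R$-modules. For a small category $\mathbf C$, $\operatorname{colim}_n^{\mathbf C}:\mathrm{Mod}_R^{\mathbf C}\to \mathrm{Mod}_R$ denotes the $n$-th left derived functor of the colimit functor. A (directed) graph $\Gamma=(A,V,s,t)$ consists of a set $A$ of arrows, a set $V$ of vertices and two functions $s,t:A\to V$ (source and target); no finiteness is assumed. An $R$-representation $F$ of $\Gamma$ is a family of left $R$-modules $\{F(v)\}_{v\in V}$ together with $R$-homomorphisms $F(\alpha):F(s(\alpha))\to F(t(\alpha))$ for $\alpha\in A$. $W\Gamma$ is the category of paths in $\Gamma$ (the free category on $\Gamma$: objects are vertices, morphisms are finite directed paths including the empty path at each vertex, composition is concatenation). $\widetilde F:W\Gamma\to\mathrm{Mod}_R$ is the unique functor extending $F$. A $1$-chain is an element $f=\{f_\gamma\}_{\gamma\in A}$ of $\bigoplus_{\gamma\in A}F(s(\gamma))$, and $d:\bigoplus_{\gamma\in A}F(s(\gamma))\to\bigoplus_{v\in V}F(v)$ is defined by $$d(f)_v=\sum_{t(\gamma)=v}F(\gamma)(f_\gamma)-\sum_{s(\gamma)=v}f_\gamma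 .$$ A $1$-chain $f$ satisfies the first Kirchhoff law in the network $(\Gamma,E,F)$ if $d(f)_v=0$ for all $v\in V\setminus E$; $\Phi(\Gamma,E;F)$ is the $R$-module of all such $1$-chains. $\Gamma\cup_E pt$ is the graph obtained from $\Gamma$ by adding one new vertex $*$ and, for each $e\in E$, one new arrow $\gamma_e$ with $s(\gamma_e)=e$ and $t(\gamma_e)=*$. $F\oplus_E 0$ is the $R$-representation of $\Gamma\cup_E pt$ which restricts to $F$ on $\Gamma$ and has value $0$ at $*$. *)

(* Defs.v *)
From HB Require Import structures.
From mathcomp Require Import all_boot all_algebra finmap.
From mathcomp Require Import boolp classical_sets functions cardinality fsbigop.

Set Implicit Arguments.
Unset Strict Implicit.
Unset Printing Implicit Defensive.
Import GRing.Theory.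
Local Open Scope classical_set_scope.
Local Open Scope ring_scope.

Definition lmod_iso (R : pzRingType) (M N : lmodType R) : Prop :=
  exists f : {linear M -> N}, bijective f.

Section KernelImage.
Variables (R : pzRingType) (M N : lmodType R) (f : {linear M -> N}).

Definition kerp : pred M := fun x => f x == 0.
Definition imp : pred N := fun y => `[< exists x, f x = y >].

Lemma kerp_submod : submod_closed kerp.
Proof.
split=> [|a x y]; first by rewrite unfold_in /kerp linear0.
by rewrite !unfold_in /kerp linearP => /eqP -> /eqP ->; rewrite scaler0 addr0.
Qed.
HB.instance Definition _ := GRing.isSubmodClosed.Build R M kerp kerp_submod.
Definition ker : submodClosed M := GRing.SubmodClosed.clone R M kerp _.

Lemma kerP x : reflect (f x = 0) (x \in ker).
Proof. exact: eqP. Qed.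


Lemma imp_submod : submod_closed imp.
Proof.
split=> [|a _ _ /asboolP[x <-] /asboolP[y <-]]; apply/asboolP.
  by exists 0; rewrite linear0.
by exists (a *: x + y); rewrite linearP.
Qed.
HB.instance Definition _ := GRing.isSubmodClosed.Build R N imp imp_submod.
Definition im : submodClosed N := GRing.SubmodClosed.clone R N imp _.

Lemma imP y : reflect (exists x, f x = y) (y \in im).
Proof. exact: asboolP. Qed.
End KernelImage.

Section SubQuotient.
Variables (R : pzRingType) (M : lmodType R) (W : submodClosed M).

Record submod := Submod { submod_val :> M; submod_in : submod_val \in W }.
HB.instance Definition _ := [isSub for submod_val].
HB.instance Definition _ := [Choice of submod by <:].
HB.instance Definition _ := [SubChoice_isSubLmodule of submod by <:].

Lemma submod_val_linear : linear submod_val.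
Proof. by []. Qed.
HB.instance Definition _ :=
  GRing.isLinear.Build R submod M *:%R submod_val submod_val_linear.

Definition submod_pred : pred M := fun x => x \in W.
Lemma submod_pred_zmod : zmod_closed submod_pred.
Proof. by apply: GRing.submod_closedB; exact: submodClosedP. Qed.
HB.instance Definition _ :=
  GRing.isZmodClosed.Build M submod_pred submod_pred_zmod.

Definition submod_zmod : zmodClosed M :=
  GRing.ZmodClosed.clone M submod_pred _.

Definition quot : Type := Quotient.quot submod_zmod.
HB.instance Definition _ := GRing.Zmodule.on quot.

Definition quot_pi (x : M) : quot := (\pi_(Quotient.quot submod_zmod) x)%qT.
Definition quot_repr (u : quot) : M := repr (u : Quotient.quot submod_zmod).

Lemma quot_reprK u : quot_pi (quot_repr u) = u.
Proof. exact: reprK. Qed.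

Lemma quot_pi_eq x y : quot_pi x = quot_pi y <-> x - y \in W.
Proof.
rewrite (Quotient.idealrBE submod_zmod).
by split=> [e|/eqP//]; apply/eqP.
Qed.

Lemma quot_piD x y : quot_pi (x + y) = quot_pi x + quot_pi y.
Proof. exact: (raddfD (\pi_(Quotient.quot submod_zmod))%qT). Qed.

Definition quot_scale (a : R) (u : quot) : quot := quot_pi (a *: quot_repr u).

Lemma quot_piZ a x : quot_pi (a *: x) = quot_scale a (quot_pi x).
Proof.
apply/quot_pi_eq; rewrite -scalerBr rpredZ //.
by apply/quot_pi_eq; rewrite quot_reprK.
Qed.

Lemma quot_scaleA a b u : quot_scale a (quot_scale b u) = quot_scale (a * b) u.
Proof. by rewrite -[u]quot_reprK -!quot_piZ scalerA. Qed.
Lemma quot_scale1 : left_id 1 quot_scale.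
Proof. by move=> u; rewrite -[u]quot_reprK -!quot_piZ scale1r. Qed.
Lemma quot_scaleDr : right_distributive quot_scale +%R.
Proof.
move=> a u v; rewrite -[u]quot_reprK -[v]quot_reprK.
by rewrite -quot_piD -!quot_piZ -quot_piD scalerDr.
Qed.
Lemma quot_scaleDl u : {morph quot_scale^~ u : a b / a + b}.
Proof. by move=> a b; rewrite -[u]quot_reprK -!quot_piZ -quot_piD scalerDl. Qed.
HB.instance Definition _ := GRing.Zmodule_isLmodule.Build R quot
  quot_scaleA quot_scale1 quot_scaleDr quot_scaleDl.

Lemma quot_pi_linear : linear quot_pi.
Proof. by move=> a x y; rewrite quot_piD quot_piZ. Qed.
HB.instance Definition _ :=
  GRing.isLinear.Build R M quot *:%R quot_pi quot_pi_linear.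
End SubQuotient.

Section QuotDesc.
Variables (R : pzRingType) (M N : lmodType R) (W : submodClosed M).
Variable (f : {linear M -> N}).

(* Only meaningful when f vanishes on W, whence the argument fW. *)
Definition quot_desc (fW : forall x, x \in W -> f x = 0) (u : quot W) : N :=
  f (quot_repr u).

Hypothesis fW : forall x, x \in W -> f x = 0.

Lemma quot_descE x : quot_desc fW (quot_pi W x) = f x.
Proof.
apply/eqP; rewrite -subr_eq0 -linearB; apply/eqP/fW/quot_pi_eq.
exact: quot_reprK.
Qed.

Lemma quot_desc_linear : linear (quot_desc fW).
Proof.
move=> a u v; rewrite -[u]quot_reprK -[v]quot_reprK -linearP !quot_descE.
exact: linearP.
Qed.
HB.instance Definition _ := GRing.isLinear.Build R (quot W) N *:%R
  (quot_desc fW) quot_desc_linear.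
End QuotDesc.

Section DirectSum.
Variables (R : pzRingType) (I : Type) (M : I -> lmodType R).

Record dsum := DSum {
  dsum_fun :> forall i, M i;
  dsum_fin : finite_set [set i | dsum_fun i != 0] }.

Lemma dsumP (f g : dsum) : (forall i, f i = g i) -> f = g.
Proof.
case: f g => f hf [g hg] /= e.
have {}e : f = g by apply: functional_extensionality_dep.
by case: _ / e hg => hg; congr DSum; exact: Prop_irrelevance.
Qed.

HB.instance Definition _ := gen_eqMixin dsum.
HB.instance Definition _ := gen_choiceMixin dsum.

Fact dsum0_fin : finite_set [set i | (0 : M i) != 0].
Proof.
suff -> : [set i | (0 : M i) != 0] = set0 by exact: finite_set0.
by apply/seteqP; split=> i //=; rewrite eqxx.
Qed.
Definition dsum0 := DSum dsum0_fin.

Fact dsumN_fin (f : dsum) : finite_set [set i | - f i != 0].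
Proof. by apply: sub_finite_set (dsum_fin f) => i /=; rewrite oppr_eq0. Qed.
Definition dsumN f := DSum (dsumN_fin f).

Fact dsumD_fin (f g : dsum) : finite_set [set i | f i + g i != 0].
Proof.
have fgfin : finite_set ([set i | f i != 0] `|` [set i | g i != 0]).
  by rewrite finite_setU; split; exact: dsum_fin.
apply: sub_finite_set fgfin => i /= h.
have [f0|] := eqVneq (f i) 0; last by left.
by right; apply: contra_neq h => ->; rewrite f0 addr0.
Qed.
Definition dsumD f g := DSum (dsumD_fin f g).

Fact dsumZ_fin a (f : dsum) : finite_set [set i | a *: f i != 0].
Proof.
apply: sub_finite_set (dsum_fin f) => i /=.
by apply: contra_neq => ->; rewrite scaler0.
Qed.
Definition dsumZ a f := DSum (dsumZ_fin a f).

Fact dsumDA : associative dsumD.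
Proof. by move=> f g h; apply: dsumP => i /=; rewrite addrA. Qed.
Fact dsumDC : commutative dsumD.
Proof. by move=> f g; apply: dsumP => i /=; rewrite addrC. Qed.
Fact dsum0D : left_id dsum0 dsumD.
Proof. by move=> f; apply: dsumP => i /=; rewrite add0r. Qed.
Fact dsumND : left_inverse dsum0 dsumN dsumD.
Proof. by move=> f; apply: dsumP => i /=; rewrite addNr. Qed.
HB.instance Definition _ :=
  GRing.isZmodule.Build dsum dsumDA dsumDC dsum0D dsumND.

Fact dsumZA a b f : dsumZ a (dsumZ b f) = dsumZ (a * b) f.
Proof. by apply: dsumP => i /=; rewrite scalerA. Qed.
Fact dsumZ1 : left_id 1 dsumZ.
Proof. by move=> f; apply: dsumP => i /=; rewrite scale1r. Qed.
Fact dsumZDr : right_distributive dsumZ +%R.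
Proof. by move=> a f g; apply: dsumP => i /=; rewrite scalerDr. Qed.
Fact dsumZDl f : {morph dsumZ^~ f : a b / a + b}.
Proof. by move=> a b; apply: dsumP => i /=; rewrite scalerDl. Qed.
HB.instance Definition _ :=
  GRing.Zmodule_isLmodule.Build R dsum dsumZA dsumZ1 dsumZDr dsumZDl.

Lemma dsum0E i : (0 : dsum) i = 0. Proof. by []. Qed.
Lemma dsumDE (f g : dsum) i : (f + g) i = f i + g i. Proof. by []. Qed.
Lemma dsumNE (f : dsum) i : (- f) i = - f i. Proof. by []. Qed.
Lemma dsumZE a (f : dsum) i : (a *: f) i = a *: f i. Proof. by []. Qed.

(* [at_ i j x] is x, transported from M i to M j, when i = j; it is 0 when
   i <> j.  The transport does not depend on the proof of i = j. *)
Definition at_ (i j : I) (x : M i) : M j :=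
  match pselect (i = j) with
  | left e => eq_rect i (fun k => M k : Type) x j e
  | right _ => 0
  end.

Lemma at_eq i x : at_ i x = x.
Proof.
rewrite /at_; case: pselect => // e.
by rewrite (Prop_irrelevance e erefl).
Qed.

Lemma at_neq i j x : i <> j -> @at_ i j x = 0.
Proof. by rewrite /at_; case: pselect. Qed.

Lemma at_linear i j : linear (@at_ i j).
Proof.
move=> a x y; case: (pselect (i = j)) => [e|ne].
  by case: _ / e; rewrite !at_eq.
by rewrite !at_neq // scaler0 addr0.
Qed.
HB.instance Definition _ i j :=
  GRing.isLinear.Build R (M i) (M j) *:%R (@at_ i j) (@at_linear i j).

Fact dsum_in_fin i (x : M i) : finite_set [set j | at_ j x != 0].
Proof.
apply: sub_finite_set (finite_set1 i) => j /=.
by case: (pselect (i = j)) => [e _|ne]; [exact: esym | rewrite at_neq // eqxx].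
Qed.
Definition dsum_in i (x : M i) : dsum := DSum (dsum_in_fin x).

Lemma dsum_in_linear i : linear (@dsum_in i).
Proof. by move=> a x y; apply: dsumP => j; rewrite /= linearP. Qed.
HB.instance Definition _ i :=
  GRing.isLinear.Build R (M i) dsum *:%R (@dsum_in i) (@dsum_in_linear i).
End DirectSum.

Section FiniteSums.
Variables (R : pzRingType) (I : Type) (M : I -> lmodType R) (N : lmodType R).
Variables (D : set I) (h : forall i, {linear M i -> N}).

(* The sum over i in D of h i (f i), all but finitely many terms of which
   are 0. *)
Definition dsum_sum (f : dsum M) : N :=
  \sum_(i \in (D : set {classic I})) h i (f i).

Lemma dsum_sumE (f : dsum M) (X : {fset {classic I}}) :
    (forall i : {classic I}, i \notin X -> f i = 0) ->
  dsum_sum f = \sum_(i <- X) (if i \in (D : set {classic I}) then h i (f i) else 0).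
Proof.
move=> fX; rewrite /dsum_sum fsbig_mkcond; apply: fsbigTE => i iX.
by rewrite /patch fX // linear0 if_same.
Qed.

Lemma dsum_suppP (f : dsum M) : exists X : {fset {classic I}},
  forall i : {classic I}, i \notin X -> f i = 0.
Proof.
have /finite_fsetP [X fX] : @finite_set {classic I} [set i | f i != 0]
  by exact: dsum_fin.
exists X => i; apply: contraNeq => fi.
have : [set` X] i by rewrite -fX.
by [].
Qed.

Lemma dsum_sum_linear : linear dsum_sum.
Proof.
move=> a f g; have [X fX] := dsum_suppP f; have [Y gY] := dsum_suppP g.
have fXY i : i \notin (X `|` Y)%fset -> f i = 0.
  by rewrite inE negb_or => /andP[/fX].
have gXY i : i \notin (X `|` Y)%fset -> g i = 0.
  by rewrite inE negb_or => /andP[_ /gY].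
rewrite (dsum_sumE fXY) (dsum_sumE gXY) (@dsum_sumE _ (X `|` Y)%fset).
  rewrite scaler_sumr -big_split /=; apply: eq_bigr => i _.
  by case: ifP => _; rewrite ?linearP // scaler0 addr0.
by move=> i iXY; rewrite dsumDE dsumZE fXY // gXY // scaler0 addr0.
Qed.
HB.instance Definition _ :=
  GRing.isLinear.Build R (dsum M) N *:%R dsum_sum dsum_sum_linear.

Lemma dsum_sum_in i (x : M i) :
  dsum_sum (dsum_in x) = if i \in D then h i x else 0.
Proof.
rewrite (@dsum_sumE _ [fset (i : {classic I})]%fset).
  by rewrite big_seq_fset1 /= at_eq.
move=> j; rewrite inE => /eqP ij; rewrite /= at_neq // => e.
exact: ij.
Qed.

End FiniteSums.

Section DirectSumDesc.
Variables (R : pzRingType) (I : Type) (M : I -> lmodType R) (N : lmodType R).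

Definition dsum_desc (h : forall i, {linear M i -> N}) :
  {linear dsum M -> N} := dsum_sum setT h.

Lemma dsum_desc_in h i (x : M i) : dsum_desc h (dsum_in x) = h i x.
Proof. by rewrite /= dsum_sum_in in_setT. Qed.

Lemma dsum_ext (g h : {linear dsum M -> N}) :
  (forall i x, g (dsum_in (i := i) x) = h (dsum_in x)) -> forall f, g f = h f.
Proof.
move=> gh f; have [X fX] := dsum_suppP f.
have -> : f = \sum_(i <- X) dsum_in (f (i : {classic I})).
  apply: dsumP => j.
  have -> : (\sum_(i <- X) dsum_in (f i)) j = \sum_(i <- X) at_ j (f i).
    elim/big_ind2: _ => // u v u' v' e e'.
    by rewrite dsumDE -e -e'.
  have [jX|jX] := boolP ((j : {classic I}) \in X).
    rewrite (big_fsetD1 (j : {classic I})) //= at_eq big_seq big1 ?addr0 //.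
    by move=> i; rewrite !inE => /andP[/eqP ij _]; rewrite at_neq.
  rewrite fX // big_seq big1 // => i iX; rewrite at_neq // => ij.
  by move: jX; rewrite -ij iX.
by rewrite !linear_sum; apply: eq_bigr => i _; exact: gh.
Qed.
End DirectSumDesc.

Record category := Category {
  obj : Type;
  hom : obj -> obj -> Type;
  idc : forall x, hom x x;
  compc : forall x y z, hom y z -> hom x y -> hom x z;
  comp1c : forall x y (h : hom x y), compc (idc y) h = h;
  compc1 : forall x y (h : hom x y), compc h (idc x) = h;
  compA : forall x y z w (h : hom z w) (g : hom y z) (k : hom x y),
    compc h (compc g k) = compc (compc h g) k }.

Record functor (R : pzRingType) (C : category) := Functor {
  fobj :> obj C -> lmodType R;
  fmap : forall x y, hom x y -> {linear fobj x -> fobj y};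
  fmap1 : forall x (a : fobj x), fmap (idc x) a = a;
  fmapM : forall x y z (h : hom y z) (g : hom x y) (a : fobj x),
    fmap (compc h g) a = fmap h (fmap g a) }.

Record nattrans (R : pzRingType) (C : category) (F G : functor R C) :=
  NatTrans {
    component :> forall x, {linear F x -> G x};
    naturality : forall x y (h : hom x y) (a : F x),
      component y (fmap F h a) = fmap G h (component x a) }.

Section FunctorCategory.
Variables (R : pzRingType) (C : category).
Implicit Types F G H P : functor R C.

Definition epi F G (p : nattrans F G) : Prop :=
  forall H (g h : nattrans G H),
    (forall x a, g x (p x a) = h x (p x a)) -> forall x b, g x b = h x b.

Definition projective P : Prop :=
  forall F G (p : nattrans F G) (f : nattrans P G), epi p ->
    exists g : nattrans P F, forall x a, p x (g x a) = f x a.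

(* Images and kernels in Mod_R^C are computed pointwise, so exactness of the
   augmented complex is pointwise. *)
Record projective_resolution F := ProjectiveResolution {
  res : nat -> functor R C;
  res_d : forall n, nattrans (res n.+1) (res n);
  res_aug : nattrans (res 0) F;
  res_projective : forall n, projective (res n);
  res_exact_aug : forall x (b : F x), exists a, res_aug x a = b;
  res_exact0 : forall x a,
    res_aug x a = 0 <-> exists b, res_d 0 x b = a;
  res_exactS : forall n x a,
    res_d n x a = 0 <-> exists b, res_d n.+1 x b = a }.
End FunctorCategory.

Section Colimit.
Variables (R : pzRingType) (C : category) (F : functor R C).

Definition arrow := {x : obj C & {y : obj C & hom x y}}.
Definition asrc (h : arrow) : obj C := projT1 h.
Definition atgt (h : arrow) : obj C := projT1 (projT2 h).
Definition ahom (h : arrow) : hom (asrc h) (atgt h) := projT2 (projT2 h).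

Definition colim_rel_at (h : arrow) (a : F (asrc h)) : dsum F :=
  dsum_in (fmap F (ahom h) a) - dsum_in a.

Lemma colim_rel_at_linear h : linear (@colim_rel_at h).
Proof.
move=> a x y; rewrite /colim_rel_at !linearP.
by rewrite scalerDr addrACA.
Qed.
HB.instance Definition _ h := GRing.isLinear.Build R (F (asrc h)) (dsum F) *:%R
  (@colim_rel_at h) (@colim_rel_at_linear h).

Definition colim_rel : {linear dsum (fun h => F (asrc h)) -> dsum F} :=
  dsum_desc (fun h => @colim_rel_at h : {linear _ -> _}).

Definition colim : lmodType R := quot (im colim_rel).

Definition colim_in x : {linear F x -> colim} :=
  quot_pi (im colim_rel) \o @dsum_in R _ F x.

Lemma colim_inE x y (h : hom x y) a : colim_in y (fmap F h a) = colim_in x a.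
Proof.
apply/quot_pi_eq/imP.
pose hh : arrow := existT _ x (existT _ y h).
by exists (dsum_in (i := hh) (M := fun h => F (asrc h)) a); rewrite dsum_desc_in.
Qed.

Section Desc.
Variables (N : lmodType R) (g : forall x, {linear F x -> N}).
Hypothesis gP : forall x y (h : hom x y) a, g y (fmap F h a) = g x a.

Lemma colim_desc_rel u : u \in im colim_rel -> dsum_desc g u = 0.
Proof.
move=> /imP[v <-]; move: v.
apply: (dsum_ext (g := dsum_desc g \o colim_rel) (h := \0)) => h x /=.
by rewrite dsum_desc_in linearB /= !dsum_sum_in !in_setT gP subrr.
Qed.

Definition colim_desc : {linear colim -> N} := quot_desc colim_desc_rel.

Lemma colim_desc_in x a : colim_desc (colim_in x a) = g x a.
Proof. by etransitivity; [exact: quot_descE | exact: dsum_desc_in]. Qed.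

Lemma colim_ext (f f' : {linear colim -> N}) :
  (forall x a, f (colim_in x a) = f' (colim_in x a)) -> forall u, f u = f' u.
Proof.
move=> ff' u; rewrite -[u]quot_reprK.
exact: (dsum_ext (g := f \o quot_pi _) (h := f' \o quot_pi _)).
Qed.
End Desc.
End Colimit.

Section ColimitMap.
Variables (R : pzRingType) (C : category) (F G : functor R C).
Variable f : nattrans F G.

Definition colim_map_at x : {linear F x -> colim G} := colim_in G x \o f x.

Lemma colim_map_atE x y (h : hom x y) a :
  colim_map_at y (fmap F h a) = colim_map_at x a.
Proof. by rewrite /colim_map_at /= naturality; exact: colim_inE. Qed.

Definition colim_map : {linear colim F -> colim G} := colim_desc colim_map_atE.
End ColimitMap.

Section Homology.
Variables (R : pzRingType) (C : nat -> lmodType R).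
Variable (d : forall n, {linear C n.+1 -> C n}).

(* The differential leaving degree n, with 0 in degree -1. *)
Definition d_out n : {linear C n -> C n.-1} :=
  match n with 0 => \0 | m.+1 => d m end.

Definition cycles n : lmodType R := submod (ker (d_out n)).

Definition cycles_val n : {linear cycles n -> C n} :=
  @submod_val R (C n) (ker (d_out n)).

Definition boundaryp n : pred (cycles n) := fun z => cycles_val n z \in im (d n).
Lemma boundaryp_submod n : submod_closed (@boundaryp n).
Proof.
split=> [|a x y hx hy]; rewrite unfold_in /boundaryp ?linear0 ?linearP.
  exact: (rpred0 (im (d n))).
by apply: (rpredD (S := im (d n))) => //; exact: rpredZ.
Qed.
HB.instance Definition _ n :=
  GRing.isSubmodClosed.Build R (cycles n) (@boundaryp n) (@boundaryp_submod n).
Definition boundaries n : submodClosed (cycles n) :=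
  GRing.SubmodClosed.clone R (cycles n) (@boundaryp n) _.

Definition homology n : lmodType R := quot (boundaries n).
End Homology.

Section EnoughProjectives.
Variables (R : pzRingType) (C : category).
Implicit Types F G P : functor R C.

Section Cokernel.
Variables (F G : functor R C) (p : nattrans F G).

Definition coker_obj x : lmodType R := quot (im (p x)).

Lemma coker_fmap_vanish x y (h : hom x y) a :
  a \in im (p x) -> (quot_pi (im (p y)) \o fmap G h) a = 0.
Proof.
move=> /imP[b <-]; rewrite /= -naturality -(linear0 (quot_pi (im (p y)))).
by apply/quot_pi_eq/imP; exists (fmap F h b); rewrite subr0.
Qed.

Definition coker_fmap x y (h : hom x y) : {linear coker_obj x -> coker_obj y} :=
  quot_desc (@coker_fmap_vanish x y h).

Lemma coker_fmapE x y (h : hom x y) a :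
  coker_fmap h (quot_pi _ a) = quot_pi _ (fmap G h a).
Proof. exact: quot_descE. Qed.

Lemma coker_fmap1 x (a : coker_obj x) : coker_fmap (idc x) a = a.
Proof. by rewrite -[a]quot_reprK coker_fmapE fmap1. Qed.

Lemma coker_fmapM x y z (h : hom y z) (g : hom x y) (a : coker_obj x) :
  coker_fmap (compc h g) a = coker_fmap h (coker_fmap g a).
Proof. by rewrite -[a]quot_reprK !coker_fmapE fmapM. Qed.

Definition coker := Functor coker_fmap1 coker_fmapM.

Definition coker_pi : nattrans G coker :=
  @NatTrans R C G coker (fun x => quot_pi (im (p x)) : {linear _ -> _})
    (fun x y h a => esym (coker_fmapE h a)).

Definition coker_zero : nattrans G coker :=
  @NatTrans R C G coker (fun x => \0 : {linear _ -> _})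
    (fun x y h a => esym (linear0 (coker_fmap h))).
End Cokernel.

Lemma epiP F G (p : nattrans F G) :
  epi p <-> forall x b, exists a, p x a = b.
Proof.
split=> [ep x b|sp H g h e x b].
  have e y a : coker_pi p y (p y a) = coker_zero p y (p y a).
    rewrite /= -(linear0 (quot_pi (im (p y)))).
    by apply/quot_pi_eq/imP; exists a; rewrite subr0.
  have := ep _ _ _ e x b.
  rewrite /= -[RHS](linear0 (quot_pi (im (p x)))) => /quot_pi_eq.
  by rewrite subr0 => /imP.
by have [a <-] := sp x b; exact: e.
Qed.

Section Kernel.
Variables (F G : functor R C) (p : nattrans F G).

Definition ker_obj x : lmodType R := submod (ker (p x)).

Lemma ker_fmap_in x y (h : hom x y) (a : ker_obj x) :
  fmap F h (submod_val a) \in ker (p y).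
Proof. by apply/kerP; rewrite naturality (kerP _ _ (submod_in a)) linear0. Qed.

Definition ker_fmap_fun x y (h : hom x y) (a : ker_obj x) : ker_obj y :=
  Submod (ker_fmap_in h a).

Lemma ker_fmap_linear x y (h : hom x y) : linear (ker_fmap_fun h).
Proof. by move=> r a b; apply: val_inj; rewrite /= linearP. Qed.
HB.instance Definition _ x y (h : hom x y) :=
  GRing.isLinear.Build R (ker_obj x) (ker_obj y) *:%R
    (ker_fmap_fun h) (ker_fmap_linear h).

Definition ker_fmap x y (h : hom x y) : {linear ker_obj x -> ker_obj y} :=
  ker_fmap_fun h.

Lemma ker_fmap1 x (a : ker_obj x) : ker_fmap (idc x) a = a.
Proof. by apply: val_inj; rewrite /= fmap1. Qed.

Lemma ker_fmapM x y z (h : hom y z) (g : hom x y) (a : ker_obj x) :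
  ker_fmap (compc h g) a = ker_fmap h (ker_fmap g a).
Proof. by apply: val_inj; rewrite /= fmapM. Qed.

Definition kerf := Functor ker_fmap1 ker_fmapM.
End Kernel.

Section Scaling.
Variables (M : lmodType R) (v : M).
Definition scaling (r : R^o) : M := (r : R) *: v.
Lemma scaling_linear : linear scaling.
Proof. by move=> a x y; rewrite /scaling scalerDl scalerA. Qed.
HB.instance Definition _ :=
  GRing.isLinear.Build R R^o M *:%R scaling scaling_linear.
End Scaling.

(* The direct sum of the representable functors R[hom x -] over all x and
   all elements of F x. *)
Section Free.
Variable F : functor R C.

Definition free_index c := {x : obj C & (F x * hom x c)%type}.
Definition free_gen c x (a : F x) (k : hom x c) : free_index c :=
  existT _ x (a, k).
Definition free_obj c : lmodType R := dsum (fun _ : free_index c => R^o).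
Definition free_elt c x (a : F x) (k : hom x c) : free_obj c :=
  dsum_in (i := free_gen a k) (M := fun=> R^o) (1 : R).

Lemma free_eltZ c x (a : F x) (k : hom x c) (r : R) :
  dsum_in (i := free_gen a k) (M := fun=> R^o) r = r *: free_elt a k.
Proof.
apply: dsumP => j; rewrite dsumZE /= -linearZ /=; congr at_.
exact: (esym (mulr1 r)).
Qed.

Definition free_fmap c c' (h : hom c c') : {linear free_obj c -> free_obj c'} :=
  dsum_desc (fun i : free_index c => @dsum_in R _ (fun=> R^o)
    (free_gen (projT2 i).1 (compc h (projT2 i).2)) : {linear _ -> _}).

Lemma free_ext c (M : lmodType R) (g h : {linear free_obj c -> M}) :
  (forall x (a : F x) k, g (free_elt a k) = h (free_elt a k)) ->
  forall u, g u = h u.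
Proof.
move=> gh; apply: dsum_ext => -[x [a k]] r.
rewrite free_eltZ !linearZ /=; congr (_ *: _); exact: gh.
Qed.

Lemma free_fmapE c c' (h : hom c c') x (a : F x) k :
  free_fmap h (free_elt a k) = free_elt a (compc h k).
Proof. exact: dsum_desc_in. Qed.

Lemma free_fmap1 c (u : free_obj c) : free_fmap (idc c) u = u.
Proof.
move: u; apply: (free_ext (g := free_fmap _) (h := idfun)) => x a k.
by rewrite free_fmapE comp1c.
Qed.

Lemma free_fmapM c c' c'' (h : hom c' c'') (g : hom c c') (u : free_obj c) :
  free_fmap (compc h g) u = free_fmap h (free_fmap g u).
Proof.
move: u; apply: (free_ext (h := free_fmap h \o free_fmap g)) => x a k.
by rewrite /= !free_fmapE compA.
Qed.

Definition free := Functor free_fmap1 free_fmapM.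

Section FreeDesc.
Variables (G : functor R C) (g : forall x, F x -> G x).

Definition free_desc_at c : {linear free c -> G c} :=
  dsum_desc (fun i : free_index c =>
    scaling (fmap G (projT2 i).2 (g (projT2 i).1)) : {linear _ -> _}).

Lemma free_desc_atE c x (a : F x) (k : hom x c) :
  free_desc_at c (free_elt a k) = fmap G k (g a).
Proof.
etransitivity; first exact: dsum_desc_in.
exact: scale1r.
Qed.

Lemma free_desc_nat c c' (h : hom c c') (u : free c) :
  free_desc_at c' (fmap free h u) = fmap G h (free_desc_at c u).
Proof.
move: u; apply: (free_ext (g := free_desc_at c' \o fmap free h)
                          (h := fmap G h \o free_desc_at c)) => x a k.
by rewrite /= free_fmapE !free_desc_atE fmapM.
Qed.

Definition free_desc : nattrans free G := NatTrans free_desc_nat.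
End FreeDesc.

Lemma free_nat_ext (G : functor R C) (g h : nattrans free G) :
  (forall x (a : F x), g x (free_elt a (idc x)) = h x (free_elt a (idc x))) ->
  forall x u, g x u = h x u.
Proof.
move=> gh c; apply: free_ext => x a k.
have -> : free_elt a k = fmap free k (free_elt a (idc x)).
  by rewrite /= free_fmapE compc1.
by rewrite !naturality gh.
Qed.

Definition free_aug : nattrans free F := free_desc (fun x a => a).

Lemma free_aug_surj x (b : F x) : exists a, free_aug x a = b.
Proof.
exists (free_elt b (idc x)); etransitivity; first exact: free_desc_atE.
exact: fmap1.
Qed.
End Free.

Definition nat_comp F G P (g : nattrans G P) (f : nattrans F G) : nattrans F P :=
  @NatTrans R C F P (fun x => g x \o f x : {linear _ -> _})
    (fun x y h a => etrans (congr1 (g y) (naturality f h a))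
                           (naturality g h (f x a))).

Lemma free_projective F : projective (free F).
Proof.
move=> A B p f /epiP sp.
have [g0 g0P] : exists g0 : forall x, F x -> A x,
    forall x a, p x (g0 x a) = f x (free_elt a (idc x)).
  exists (fun x a => projT1 (cid (sp x (f x (free_elt a (idc x)))))) => x a.
  by case: cid.
exists (free_desc g0) => x u.
apply: (free_nat_ext (g := nat_comp p (free_desc g0))) => {u}x a.
rewrite -g0P -[in RHS](fmap1 (g0 x a)) -free_desc_atE.
by [].
Qed.

Section Resolution.
Variable F : functor R C.

Fixpoint syzygy n : functor R C :=
  match n with 0 => F | m.+1 => kerf (free_aug (syzygy m)) end.

Definition syzygy_incl n : nattrans (syzygy n.+1) (free (syzygy n)) :=
  @NatTrans R C (syzygy n.+1) (free (syzygy n))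
    (fun x => @submod_val R (free (syzygy n) x) (ker (free_aug (syzygy n) x))
              : {linear _ -> _})
    (fun x y h a => erefl).

Definition free_res_d n : nattrans (free (syzygy n.+1)) (free (syzygy n)) :=
  nat_comp (syzygy_incl n) (free_aug (syzygy n.+1)).

Lemma free_res_exact n x a :
  free_aug (syzygy n) x a = 0 <-> exists b, free_res_d n x b = a.
Proof.
split=> [/kerP ka|[b <-]]; last first.
  exact: (kerP _ _ (submod_in (free_aug (syzygy n.+1) x b))).
have [b e] := free_aug_surj (F := syzygy n.+1) (x := x) (Submod ka).
by exists b; rewrite [LHS]/= [X in submod_val X]e.
Qed.

Lemma free_res_exactS n x a :
  free_res_d n x a = 0 <-> exists b, free_res_d n.+1 x b = a.
Proof.
rewrite -free_res_exact; split=> [e|e]; first exact: val_inj.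
by rewrite [LHS]/= [X in submod_val X]e.
Qed.

Lemma projective_resolution_exists :
  exists P : projective_resolution F, True.
Proof.
by exists (ProjectiveResolution (fun n => @free_projective (syzygy n))
  (@free_aug_surj F) (@free_res_exact 0) free_res_exactS).
Qed.
End Resolution.
End EnoughProjectives.

Section DerivedColimit.
Variables (R : pzRingType) (C : category).

Definition chosen_resolution (F : functor R C) : projective_resolution F :=
  projT1 (cid (projective_resolution_exists F)).

(* The n-th left derived functor of the colimit functor Mod_R^C -> Mod_R, on
   objects.  It is computed from an arbitrary chosen projective resolution;
   other choices give isomorphic modules. *)
Definition colimn (n : nat) (F : functor R C) : lmodType R :=
  homology (C := fun m => colim (res (chosen_resolution F) m))
    (fun m => colim_map (res_d (chosen_resolution F) m)) n.
End DerivedColimit.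

Record graph := Graph {
  arr : Type;
  vert : Type;
  src : arr -> vert;
  tgt : arr -> vert }.

Record representation (R : pzRingType) (Gam : graph) := Representation {
  rep :> vert Gam -> lmodType R;
  rep_map : forall a : arr Gam, {linear rep (src a) -> rep (tgt a)} }.

Section PathCategory.
Variable Gam : graph.

(* Paths grow at their target; [pcat q p] is p followed by q. *)
Inductive gpath (x : vert Gam) : vert Gam -> Type :=
| pnil : gpath x x
| psnoc (a : arr Gam) : gpath x (src a) -> gpath x (tgt a).

Fixpoint pcat x y z (q : gpath y z) (p : gpath x y) : gpath x z :=
  match q in gpath _ z' return gpath x z' with
  | pnil => p
  | psnoc a q' => psnoc (pcat q' p)
  end.

Lemma pcat_nil x y (q : gpath x y) : pcat q (pnil x) = q.
Proof. by elim: q => //= a q ->. Qed.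

Lemma pcatA x y z w (r : gpath z w) (q : gpath y z) (p : gpath x y) :
  pcat r (pcat q p) = pcat (pcat r q) p.
Proof. by elim: r => //= a r ->. Qed.

Definition path_category : category :=
  @Category (vert Gam) gpath pnil (fun x y z q p => pcat q p)
    (fun x y p => erefl) pcat_nil pcatA.

Variables (R : pzRingType) (F : representation R Gam).

Fixpoint path_map x y (p : gpath x y) : {linear F x -> F y} :=
  match p in gpath _ y' return {linear F x -> F y'} with
  | pnil => idfun
  | psnoc a p' => rep_map F a \o path_map p'
  end.

Lemma path_mapM x y z (q : gpath y z) (p : gpath x y) (m : F x) :
  path_map (pcat q p) m = path_map q (path_map p m).
Proof. by elim: q => //= a q ->. Qed.

Definition path_functor : functor R path_category :=
  @Functor R path_category F path_map (fun x m => erefl) path_mapM.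
End PathCategory.

Section Kirchhoff.
Variables (R : pzRingType) (Gam : graph) (F : representation R Gam).

Definition chain1 : lmodType R := dsum (fun a : arr Gam => F (src a)).

(* In each summand at_ is a transport along t(a) = v, resp. s(a) = v. *)
Definition bdry_at (f : chain1) (v : vert Gam) : F v :=
  \sum_(a \in [set a : {classic (arr Gam)} | tgt a = v])
     at_ v (rep_map F a (f a))
  - \sum_(a \in [set a : {classic (arr Gam)} | src a = v]) at_ v (f a).

Lemma bdry_at_fin (f : chain1) : finite_set [set v | bdry_at f v != 0].
Proof.
have finU : finite_set (@tgt Gam @` [set a | f a != 0] `|`
                        @src Gam @` [set a | f a != 0]).
  by rewrite finite_setU; split; apply: finite_image; exact: dsum_fin.
apply: sub_finite_set finU => v /=; apply: contra_neqP => nv.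
rewrite /bdry_at !fsbig1 ?subr0 // => a /= av.
  have [->|fa] := eqVneq (f a) 0; first by rewrite linear0.
  by case: nv; right; exists a.
have [->|fa] := eqVneq (f a) 0; first by rewrite !linear0.
by case: nv; left; exists a.
Qed.

Definition bdry (f : chain1) : dsum F := DSum (bdry_at_fin f).

Lemma bdry_linear : linear bdry.
Proof.
move=> r f g; apply: dsumP => v.
pose dt := dsum_sum [set a : arr Gam | tgt a = v]
  (fun a => at_ v \o rep_map F a : {linear F (src a) -> F v}).
pose ds := dsum_sum [set a : arr Gam | src a = v]
  (fun a => @at_ _ _ F (src a) v : {linear F (src a) -> F v}).
change (dt (r *: f + g) - ds (r *: f + g)
        = r *: (dt f - ds f) + (dt g - ds g)).
by rewrite /dt /ds !linearP scalerDr addrACA.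
Qed.
HB.instance Definition _ :=
  GRing.isLinear.Build R chain1 (dsum F) *:%R bdry bdry_linear.

Variable E : set (vert Gam).

Definition kirchhoffp : pred chain1 :=
  fun f => `[< forall v, ~ E v -> bdry f v = 0 >].

Lemma kirchhoffp_submod : submod_closed kirchhoffp.
Proof.
split=> [|r f g /asboolP hf /asboolP hg]; apply/asboolP => v Ev.
  by rewrite linear0.
by rewrite linearP dsumDE dsumZE hf // hg // scaler0 addr0.
Qed.
HB.instance Definition _ :=
  GRing.isSubmodClosed.Build R chain1 kirchhoffp kirchhoffp_submod.

Definition Phi : lmodType R :=
  submod (GRing.SubmodClosed.clone R chain1 kirchhoffp _).
End Kirchhoff.

Section Cone.
Variables (Gam : graph) (E : set (vert Gam)).

(* Gam \cup_E pt: the new vertex * is None, and inr e is the arrow e -> *. *)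
Definition cone : graph := @Graph
  (arr Gam + {e : vert Gam | E e}) (option (vert Gam))
  (fun a => match a with inl b => Some (src b) | inr e => Some (sval e) end)
  (fun a => match a with inl b => Some (tgt b) | inr _ => None end).

Variables (R : pzRingType) (F : representation R Gam).

Definition cone_rep_at (v : vert cone) : lmodType R :=
  match v with Some w => F w | None => 'rV[R]_0 end.

Definition cone_rep_map (a : arr cone) :
    {linear cone_rep_at (src a) -> cone_rep_at (tgt a)} :=
  match a with inl b => rep_map F b | inr _ => \0 end.

Definition cone_rep : representation R cone := Representation cone_rep_map.
End Cone.

(* Main.v *)
(** For a functor G on the category of paths, the cokernel of
    d_G : (+)_a G(s a) -> (+)_v G(v) is colim G, because the relations given by
    paths follow from those given by arrows.  Both direct sums are exact in G.
    On a direct sum of representables d_G has a left inverse, which sends a path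
    to the sum of its arrows (each tagged with the part of the path before it);
    so d_P is injective for P projective.  The snake argument on a projective
    resolution then identifies colim_1 G with ker d_G.  Finally, in the cone
    graph the component on the new arrow e -> * of an element of ker d is forced
    to be the boundary at e of its restriction to the old graph, while nothing
    is added to the equations outside E. *)
From HB Require Import structures.
From mathcomp Require Import all_boot all_algebra.
From mathcomp Require Import boolp classical_sets functions cardinality.
Require Import Defs.

Set Implicit Arguments.
Unset Strict Implicit.
Unset Printing Implicit Defensive.
Import GRing.Theory.
Local Open Scope classical_set_scope.
Local Open Scope ring_scope.

(** * Module isomorphisms from linear relations *)

(** Subtracting two related pairs that share an entry gives a related pair with entry 0, so the last
    two hypotheses make [T] injective and single-valued. *)
Lemma lmod_iso_of_rel (R : pzRingType) (M N : lmodType R) (T : M -> N -> Prop) :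
  (forall a x y x' y', T x y -> T x' y' -> T (a *: x + x') (a *: y + y')) ->
  (forall x, exists y, T x y) -> (forall y, exists x, T x y) ->
  (forall x, T x 0 -> x = 0) -> (forall y, T 0 y -> y = 0) ->
  lmod_iso M N.
Proof.
move=> Tlin Tl Tr T0l T0r.
have Tfun x y y' : T x y -> T x y' -> y = y'.
  move=> h h'; apply/esym/eqP; rewrite -subr_eq0 addrC -scaleN1r.
  by apply/eqP/T0r; rewrite -(addNr x) -(scaleN1r x); exact: Tlin.
have Tinj x x' y : T x y -> T x' y -> x = x'.
  move=> h h'; apply/esym/eqP; rewrite -subr_eq0 addrC -scaleN1r.
  by apply/eqP/T0l; rewrite -(addNr y) -(scaleN1r y); exact: Tlin.
pose f x := projT1 (cid (Tl x)); have fT x : T x (f x) by rewrite /f; case: cid.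
pose g y := projT1 (cid (Tr y)); have gT y : T (g y) y by rewrite /g; case: cid.
have flin : linear f by move=> a x y; apply: Tfun (fT _) (Tlin _ _ _ _ _ _ _).
pose F : {linear M -> N} := HB.pack f (GRing.isLinear.Build R M N *:%R f flin).
exists F; exists g => [x|y]; first exact: Tinj (gT _) (fT _).
exact: Tfun (fT _) (gT _).
Qed.

Lemma lmod_iso_of_inj_surj (R : pzRingType) (M N : lmodType R)
    (f : {linear M -> N}) :
  (forall x, f x = 0 -> x = 0) -> (forall y, exists x, f x = y) ->
  lmod_iso N M.
Proof.
move=> finj fsurj; apply: (@lmod_iso_of_rel _ _ _ (fun y x => f x = y)).
- by move=> a _ x _ x' <- <-; rewrite linearP.
- exact: fsurj.
- by move=> x; exists (f x).
- by move=> y <-; rewrite linear0.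
- exact: finj.
Qed.

Lemma lmod_iso_trans (R : pzRingType) (M N P : lmodType R) :
  lmod_iso M N -> lmod_iso N P -> lmod_iso M P.
Proof. by move=> [f fb] [g gb]; exists (g \o f); exact: bij_comp. Qed.

(** * Componentwise maps of direct sums *)

Section DirectSumMap.
Variables (R : pzRingType) (I : Type).

Section Map.
Variables (M N : I -> lmodType R) (h : forall i, {linear M i -> N i}).

Fact dsum_map_fin (f : dsum M) : finite_set [set i | h i (f i) != 0].
Proof.
apply: sub_finite_set (dsum_fin f) => i /=.
by apply: contra_neq => ->; rewrite linear0.
Qed.
Definition dsum_map_fun f := DSum (dsum_map_fin f).

Lemma dsum_map_linear : linear dsum_map_fun.
Proof. by move=> a f g; apply: dsumP => i; rewrite /= linearP. Qed.
HB.instance Definition _ :=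
  GRing.isLinear.Build R (dsum M) (dsum N) *:%R dsum_map_fun dsum_map_linear.
Definition dsum_map : {linear dsum M -> dsum N} := dsum_map_fun.

Lemma dsum_map_in i (x : M i) : dsum_map (dsum_in x) = dsum_in (h i x).
Proof.
apply: dsumP => j /=; case: (pselect (i = j)) => [e|ne].
  by case: _ / e; rewrite !at_eq.
by rewrite !at_neq // linear0.
Qed.

(** Preimages are chosen summand by summand, with 0 chosen over 0; this keeps the support finite. *)
Lemma dsum_map_lift (u : dsum N) :
  (forall i, exists x, h i x = u i) -> exists w, dsum_map w = u.
Proof.
move=> hu; have g i : {x | h i x = u i & u i = 0 -> x = 0}.
  have [u0|u0] := eqVneq (u i) 0; first by exists 0; rewrite ?linear0.
  by have [x hx] := cid (hu i); exists x => // /eqP; rewrite (negPf u0).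
have gfin : finite_set [set i | s2val (g i) != 0].
  apply: sub_finite_set (dsum_fin u) => i /=.
  by apply: contra_neq; exact: (s2valP' (g i)).
by exists (DSum gfin); apply: dsumP => i; exact: (s2valP (g i)).
Qed.
End Map.

Lemma dsum_map_exact (M N P : I -> lmodType R)
    (f : forall i, {linear M i -> N i}) (g : forall i, {linear N i -> P i}) u :
  (forall i x, g i x = 0 -> exists y, f i y = x) ->
  dsum_map g u = 0 -> exists w, dsum_map f w = u.
Proof.
move=> ex gu; apply: dsum_map_lift => i; apply: ex.
by rewrite -[RHS](dsum0E P i) -gu.
Qed.

Lemma dsum_map_comp0 (M N P : I -> lmodType R)
    (f : forall i, {linear M i -> N i}) (g : forall i, {linear N i -> P i}) u :
  (forall i x, g i (f i x) = 0) -> dsum_map g (dsum_map f u) = 0.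
Proof. by move=> gf; apply: dsumP => i; exact: gf. Qed.
End DirectSumMap.

(** * Colimits as quotients of direct sums *)

Section ColimitPresentation.
Variables (R : pzRingType) (C : category).

Definition colim_pi (G : functor R C) : {linear dsum G -> colim G} :=
  quot_pi (im (colim_rel G)).

Lemma colim_pi_surj G (u : colim G) : exists x, colim_pi G x = u.
Proof. by exists (quot_repr u); exact: quot_reprK. Qed.

Lemma colim_map_pi F G (f : nattrans F G) u :
  colim_map f (colim_pi F u) = colim_pi G (dsum_map f u).
Proof.
move: u; apply: (dsum_ext (g := colim_map f \o colim_pi F)
                          (h := colim_pi G \o dsum_map f)) => x a.
rewrite /= -[dsum_map_fun _ _]/(dsum_map f _) dsum_map_in.
exact: (colim_desc_in (colim_map_atE f)).
Qed.
End ColimitPresentation.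

(** * The boundary map of a functor on the path category *)

Section PathBoundary.
Variables (R : pzRingType) (Gam : graph).
Local Notation C := (path_category Gam).
Implicit Types (G P : functor R C).

Definition edge (a : arr Gam) : hom (c := C) (src a) (tgt a) :=
  psnoc (pnil (src a)).

(** Chains are taken over arbitrary functors, since the terms of a resolution do not come as
    representations. *)
Definition pchain G : lmodType R := dsum (fun a : arr Gam => G (src a)).

Definition pbdry_at G a : {linear G (src a) -> dsum G} :=
  (@dsum_in R _ G (tgt a) \o fmap G (edge a)) \- @dsum_in R _ G (src a).

Definition pbdry G : {linear pchain G -> dsum G} := dsum_desc (pbdry_at G).

Lemma pbdry_in G a (x : G (src a)) :
  pbdry G (dsum_in (M := fun a => G (src a)) x) =
  dsum_in (fmap G (edge a) x) - dsum_in x.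
Proof. exact: dsum_desc_in. Qed.

Lemma pbdry_nat G P (f : nattrans G P) u :
  pbdry P (dsum_map (fun a => f (src a)) u) = dsum_map f (pbdry G u).
Proof.
move: u; apply: (dsum_ext (g := pbdry P \o dsum_map (fun a => f (src a)))
                          (h := dsum_map f \o pbdry G)) => a x.
rewrite [LHS]/= [RHS]/= -/(pbdry G _) pbdry_in.
rewrite -[dsum_map_fun _ _]/(dsum_map (fun a => f (src a)) _) dsum_map_in.
rewrite -[in RHS]/(dsum_map f _) linearB !dsum_map_in naturality.
exact: pbdry_in.
Qed.

(** A telescoping sum: each arrow carries the image of [m] under the part of the path before it. *)
Lemma pbdry_path G x y (p : gpath x y) (m : G x) :
  exists w, pbdry G w = dsum_in (fmap G (p : hom (c := C) x y) m) - dsum_in m.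
Proof.
elim: p => [|a q [w IH]].
  exists 0; rewrite linear0 -[pnil x]/(idc (c := C) x) fmap1.
  by rewrite subrr.
pose q' : hom (c := C) x (src a) := q.
exists (w + dsum_in (M := fun a => G (src a)) (fmap G q' m)).
rewrite linearD IH pbdry_in -fmapM addrC addrA subrK.
by [].
Qed.

Lemma colim_pi_eq0 G u : colim_pi G u = 0 <-> exists w, pbdry G w = u.
Proof.
rewrite -(linear0 (colim_pi G)) quot_pi_eq subr0; split=> [/imP[v <-]|[w <-]].
  (* Membership in an image becomes vanishing in the quotient by it, an equality of linear maps that
     [dsum_ext] checks on generators. *)
  apply/imP; rewrite -[colim_rel G v]subr0; apply/quot_pi_eq; move: v.
  apply: (dsum_ext (g := quot_pi (im (pbdry G)) \o colim_rel G)
                   (h := quot_pi (im (pbdry G)) \o \0)) => -[x [y p]] m.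
  apply/quot_pi_eq/imP; rewrite /= subr0.
  have [w wE] := pbdry_path (G := G) p m.
  by exists w; rewrite wE; exact/esym/dsum_desc_in.
rewrite -[pbdry G w]subr0; apply/quot_pi_eq; move: w.
apply: (dsum_ext (g := quot_pi (im (colim_rel G)) \o pbdry G)
                 (h := quot_pi (im (colim_rel G)) \o \0)) => a m.
apply/quot_pi_eq/imP; rewrite [X in _ - X]/= subr0.
pose e : arrow C := existT _ (src a) (existT _ (tgt a) (edge a)).
exists (dsum_in (i := e) (M := fun h => G (asrc h)) m).
by rewrite dsum_desc_in; exact/esym/pbdry_in.
Qed.

(** * A retraction of the boundary on free functors *)

Section Free.
Variable F : functor R C.

Definition prefix_gen a x (m : F x) (p : gpath x (src a)) : pchain (free F) :=
  dsum_in (i := a) (M := fun a => free F (src a))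
    (free_elt m (p : hom (c := C) x (src a))).

Fixpoint prefix_sum x (m : F x) y (p : gpath x y) : pchain (free F) :=
  match p with
  | pnil => 0
  | psnoc a q => prefix_sum m q + prefix_gen m q
  end.

Definition pbdry_retract : {linear dsum (free F) -> pchain (free F)} :=
  dsum_desc (fun v => dsum_desc (fun i : free_index F v =>
    scaling (prefix_sum (projT2 i).1 (projT2 i).2) : {linear _ -> _})).

Lemma pbdry_retractE v x (m : F x) (p : hom (c := C) x v) :
  pbdry_retract (dsum_in (free_elt m p : free F v)) = prefix_sum m p.
Proof.
etransitivity; first exact: dsum_desc_in.
etransitivity; first exact: dsum_desc_in.
exact: scale1r.
Qed.

(** The boundary of [prefix_gen m p] is the path [p] extended by [a] minus [p] itself, and the
    prefix sums of these two paths differ exactly by [prefix_gen m p]. *)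
Lemma pbdry_retractK u : pbdry_retract (pbdry (free F) u) = u.
Proof.
move: u; apply: (dsum_ext (g := pbdry_retract \o pbdry (free F))
                          (h := idfun)) => a.
(* Naming the inclusion of the summand at [a] makes both sides linear maps on a free module, where
   [free_ext] applies. *)
pose i := @dsum_in _ _ (fun a => free F (src a)) a : {linear _ -> _}.
change (forall x, (pbdry_retract \o pbdry (free F) \o i) x = i x).
apply: free_ext => x m p.
change (pbdry_retract (pbdry (free F) (prefix_gen m p)) = prefix_gen m p).
rewrite pbdry_in [fmap _ _ _]free_fmapE linearB !pbdry_retractE.
by rewrite -[prefix_sum m _]/(prefix_sum m p + prefix_gen m p) addrC addKr.
Qed.
End Free.

(** [P] is a retract of [free P]: a section of [free_aug P] carries [u] to a chain with zero
    boundary, which the retraction forces to be 0. *)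
Lemma pbdry_projective_inj P u : projective P -> pbdry P u = 0 -> u = 0.
Proof.
move=> Pproj du.
have ep : epi (free_aug P) by apply/epiP; exact: free_aug_surj.
pose idP : nattrans P P :=
  @NatTrans R C P P (fun x => idfun : {linear _ -> _}) (fun x y h a => erefl).
have [s sK] := Pproj _ _ _ idP ep.
have su : dsum_map (fun a => s (src a)) u = 0.
  by rewrite -[LHS]pbdry_retractK pbdry_nat du !linear0.
apply: dsumP => a; rewrite -[LHS](sK (src a)).
by rewrite -[s _ _]/(dsum_map (fun a => s (src a)) u a) su linear0.
Qed.

(** * The snake argument on a projective resolution *)

Lemma colim1_iso_ker F (Q : projective_resolution F) :
  lmod_iso (submod (ker (pbdry F)))
    (homology (C := fun m => colim (res Q m))
       (fun m => colim_map (res_d Q m)) 1).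
Proof.
pose H := homology (C := fun m => colim (res Q m))
  (fun m => colim_map (res_d Q m)) 1.
pose Z := cycles (C := fun m => colim (res Q m))
  (fun m => colim_map (res_d Q m)) 1.
pose cls : {linear Z -> H} := quot_pi (boundaries _ 1).
have cls0 (c : Z) :
    cls c = 0 <-> exists u, colim_map (res_d Q 1) u = submod_val c.
  rewrite -(linear0 cls) quot_pi_eq subr0; split=> [/imP //|e].
  exact/imP.
pose aug1 := dsum_map (fun a => res_aug Q (src a)) :
   {linear pchain _ -> pchain F}.
pose del1 n := dsum_map (fun a => res_d Q n (src a)) :
   {linear pchain (res Q n.+1) -> pchain (res Q n)}.
(* The connecting homomorphism as a relation: lift [z] to [y], lift the boundary of [y] to [x], and
   take the class of [x] in the colimit. No choice of lifts is fixed. *)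
pose T (z : submod (ker (pbdry F))) (h : H) := exists y x (c : Z),
  [/\ aug1 y = submod_val z, pbdry (res Q 0) y = dsum_map (res_d Q 0) x,
      submod_val c = colim_pi _ x & cls c = h].
apply: (@lmod_iso_of_rel _ _ _ T).
- move=> a z h z' h' [y [x [c [yz dy cx ch]]]] [y' [x' [c' [yz' dy' cx' ch']]]].
  exists (a *: y + y'), (a *: x + x'), (a *: c + c'); split.
  + by rewrite linearP yz yz'.
  + by rewrite !linearP dy dy'.
  + by rewrite [RHS]linearP -cx -cx'.
  + by rewrite linearP ch ch'.
(* Augmenting the boundary of [y] gives the boundary of [z], which is 0, so [x] exists by
   exactness. *)
- move=> z.
  have [y yz] : exists y, aug1 y = submod_val z.
    by apply: dsum_map_lift => a; exact: res_exact_aug.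
  have [x xy] : exists x, dsum_map (res_d Q 0) x = pbdry (res Q 0) y.
    apply: (dsum_map_exact (g := res_aug Q)); first by move=> i b /res_exact0.
    by rewrite -pbdry_nat -/aug1 yz; exact/kerP/submod_in.
  have cx : colim_pi _ x \in ker (colim_map (res_d Q 0)).
    by apply/kerP; rewrite colim_map_pi xy; apply/colim_pi_eq0; exists y.
  by exists (cls (Submod cx)), y, x, (Submod cx).
(* The diagram read backwards: the image of [x] under [res_d Q 0] dies in the colimit, so it is the
   boundary of some [y]. *)
- move=> h; pose c : Z := quot_repr h; have ch : cls c = h := quot_reprK h.
  have [x cx] := colim_pi_surj (submod_val c).
  have [y dy] : exists y, pbdry (res Q 0) y = dsum_map (res_d Q 0) x.
    by apply/colim_pi_eq0; rewrite -colim_map_pi cx;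
       exact/(kerP _ _ (submod_in c)).
  have zk : aug1 y \in ker (pbdry F).
    apply/kerP; rewrite pbdry_nat dy; apply: dsum_map_comp0 => v b.
    by apply/res_exact0; exists b.
  by exists (Submod zk), y, x, c.
(* Injectivity: corrected by the image of [b], [x] is the boundary of some [w], so [y] and
   [del1 0 w] have equal boundaries. Projectivity of [res Q 0] makes them equal, and augmentation
   kills [del1 0 w]. *)
- move=> z [y [x [c [yz dy cx /cls0[u uc]]]]].
  have [b ub] := colim_pi_surj u.
  have /colim_pi_eq0[w dw] : colim_pi _ (x - dsum_map (res_d Q 1) b) = 0.
    by rewrite linearB -colim_map_pi ub uc cx subrr.
  have yw : y = del1 0 w.
    apply/eqP; rewrite -subr_eq0; apply/eqP.
    suff : pbdry (res Q 0) (y - del1 0 w) = 0.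
      exact: (pbdry_projective_inj (@res_projective _ _ _ Q 0)).
    rewrite linearB dy pbdry_nat dw linearB dsum_map_comp0 ?subr0 ?subrr //.
    by move=> v e; apply/res_exactS; exists e.
  apply: val_inj; rewrite /= -yz yw; apply: dsum_map_comp0 => a e.
  by apply/res_exact0; exists e.
(* Single-valuedness: [y] lifts to [w], and [x] differs from the boundary of [w] by the image of
   [b], so the class of [x] comes from that of [b]. *)
- move=> h [y [x [c [yz dy cx <-]]]]; apply/cls0; rewrite cx.
  have [w wy] : exists w, del1 0 w = y.
    by apply: dsum_map_exact yz => a e /res_exact0.
  have [b xb] : exists b, dsum_map (res_d Q 1) b = x - pbdry (res Q 1) w.
    apply: (dsum_map_exact (g := res_d Q 0)); first by move=> v e /res_exactS.
    by rewrite linearB -dy -pbdry_nat -/(del1 0) wy subrr.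
  exists (colim_pi _ b); rewrite colim_map_pi xb linearB.
  suff -> : colim_pi _ (pbdry (res Q 1) w) = 0 by rewrite subr0.
  by apply/colim_pi_eq0; exists w.
Qed.
End PathBoundary.

(** * The network boundary on generators, and coordinate projections *)

Lemma bdry_in (R : pzRingType) (Gam : graph) (F : representation R Gam)
    (a : arr Gam) (x : F (src a)) :
  bdry (dsum_in (M := fun a => F (src a)) x) =
  dsum_in (rep_map F a x) - dsum_in x.
Proof.
apply: dsumP => v; rewrite dsumDE dsumNE.
pose dt := dsum_sum [set a : arr Gam | tgt a = v]
  (fun a => at_ v \o rep_map F a : {linear F (src a) -> F v}).
pose ds := dsum_sum [set a : arr Gam | src a = v]
  (fun a => @at_ _ _ F (src a) v : {linear F (src a) -> F v}).
(* The two sums defining [bdry] are instances of [dsum_sum], whose value on a generator is known. *)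
change (dt (dsum_in (M := fun a => F (src a)) x) -
        ds (dsum_in (M := fun a => F (src a)) x) =
        at_ v (rep_map F a x) - at_ v x).
rewrite /dt /ds !dsum_sum_in; congr (_ - _).
  by case: ifPn => //; rewrite notin_setE => nv; rewrite at_neq.
by case: ifPn => //; rewrite notin_setE => nv; rewrite at_neq.
Qed.

Section Projection.
Variables (R : pzRingType) (I : Type) (M : I -> lmodType R) (i : I).

Definition dsum_proj_fun (f : dsum M) : M i := f i.
Lemma dsum_proj_linear : linear dsum_proj_fun.
Proof. by []. Qed.
HB.instance Definition _ := GRing.isLinear.Build R (dsum M) (M i) *:%R
  dsum_proj_fun dsum_proj_linear.
Definition dsum_proj : {linear dsum M -> M i} := dsum_proj_fun.
End Projection.

(** * The kernel of the boundary over the cone graph *)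

Section ConeKernel.
Variables (R : pzRingType) (Gam : graph) (E : set (vert Gam)).
Variable F : representation R Gam.
Local Notation Fc := (path_functor (cone_rep E F)).

Lemma at_some (v w : vert Gam) (x : F v) :
  at_ (M := cone_rep E F) (i := Some v) (Some w) x = at_ w x.
Proof.
case: (pselect (v = w)) => [e|ne]; first by case: _ / e; rewrite !at_eq.
by rewrite !at_neq // => -[].
Qed.

Fact cone_restr_fin (g : pchain Fc) :
  finite_set [set a : arr Gam | (g (inl a) : F (src a)) != 0].
Proof.
apply: (finite_preimage (f := inl) (B := [set a | g a != 0])).
  by move=> ? ? _ _ [].
exact: dsum_fin.
Qed.
Definition cone_restr_fun (g : pchain Fc) : chain1 F := DSum (cone_restr_fin g).

Lemma cone_restr_linear : linear cone_restr_fun.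
Proof. by move=> a f g; apply: dsumP. Qed.
HB.instance Definition _ := GRing.isLinear.Build R (pchain Fc) (chain1 F) *:%R
  cone_restr_fun cone_restr_linear.
Definition cone_restr : {linear pchain Fc -> chain1 F} := cone_restr_fun.

(* The component of g on the arrow v -> *; 0 if v is not in E. *)
Definition cone_flow_fun v (g : pchain Fc) : F v :=
  match pselect (E v) with
  | left Ev => g (inr (exist _ v Ev))
  | right _ => 0
  end.

Lemma cone_flow_linear v : linear (cone_flow_fun v).
Proof.
rewrite /cone_flow_fun => a f g.
by case: pselect => // _; rewrite scaler0 addr0.
Qed.
HB.instance Definition _ v := GRing.isLinear.Build R (pchain Fc) (F v) *:%R
  (cone_flow_fun v) (cone_flow_linear v).
Definition cone_flow v : {linear pchain Fc -> F v} := cone_flow_fun v.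

(** Old arrows contribute as in [Gam]; a new arrow only leaves its old endpoint, so its flow enters
    with a minus sign. *)
Lemma pbdry_coneE g v :
  (pbdry Fc g (Some v) : F v) = bdry (cone_restr g) v - cone_flow v g.
Proof.
move: g; apply: (dsum_ext (N := F v)
  (g := dsum_proj Fc (Some v) \o pbdry Fc)
  (h := (dsum_proj F v \o (@bdry R Gam F \o cone_restr)) \- cone_flow v)).
move=> a x.
change ((pbdry Fc (dsum_in (M := fun a => Fc (src a)) x) (Some v) : F v) =
  bdry (cone_restr (dsum_in (M := fun a => Fc (src a)) x)) v -
  cone_flow v (dsum_in (M := fun a => Fc (src a)) x)).
rewrite pbdry_in dsumDE dsumNE.
case: a x => [b|[e Ee]] x.
  have -> : cone_restr (dsum_in (M := fun a => Fc (src a)) x) =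
            dsum_in (M := fun a => F (src a)) (x : F (src b)).
    apply: dsumP => c /=; case: (pselect (b = c)) => [e|ne].
      by case: _ / e; rewrite !at_eq.
    by rewrite !at_neq // => -[].
  have -> : cone_flow v (dsum_in (M := fun a => Fc (src a)) x) = 0.
    rewrite /cone_flow /= /cone_flow_fun; case: pselect => // Ev.
    by rewrite /= at_neq.
  rewrite bdry_in dsumDE dsumNE subr0.
  by congr (_ - _); exact: at_some.
have -> : cone_restr (dsum_in (M := fun a => Fc (src a)) x) = 0.
  by apply: dsumP => c /=; rewrite at_neq.
rewrite [bdry 0]linear0; congr (_ - _); first by rewrite [LHS]/= at_neq.
rewrite [LHS]/= /cone_flow /= /cone_flow_fun; case: pselect => [Ev|nEv] /=.
  case: (pselect (e = v)) => [ev|ne].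
    move: Ev; case: _ / ev => Ev; rewrite (Prop_irrelevance Ev Ee).
    by rewrite !at_eq.
  by rewrite !at_neq // => -[].
by rewrite at_neq // => -[ev]; apply: nEv; rewrite -ev.
Qed.

Lemma pbdry_cone_eq0 g :
  pbdry Fc g = 0 <-> forall v, bdry (cone_restr g) v = cone_flow v g.
Proof.
split=> [g0 v|gv].
  by apply/eqP; rewrite -subr_eq0 -pbdry_coneE g0.
(* At the new vertex the value is a row vector of length 0, so no equation arises there. *)
apply: dsumP => -[v|]; last by apply/matrixP => ? [].
by rewrite [LHS]pbdry_coneE gv subrr.
Qed.

Lemma cone_restr_kirchhoff (z : submod (ker (pbdry Fc))) :
  cone_restr (submod_val z) \in kirchhoffp E (F := F).
Proof.
apply/asboolP => v nEv.
have /kerP/pbdry_cone_eq0 -> := submod_in z.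
by rewrite /cone_flow /= /cone_flow_fun; case: pselect.
Qed.

Definition ker_restr_fun (z : submod (ker (pbdry Fc))) : Phi F E :=
  Submod (cone_restr_kirchhoff z).

Lemma ker_restr_linear : linear ker_restr_fun.
Proof. by move=> a f g; apply: val_inj; rewrite /= linearP. Qed.
HB.instance Definition _ :=
  GRing.isLinear.Build R (submod (ker (pbdry Fc))) (Phi F E) *:%R
    ker_restr_fun ker_restr_linear.
Definition ker_restr : {linear submod (ker (pbdry Fc)) -> Phi F E} :=
  ker_restr_fun.

Definition cone_ext_at (f : chain1 F) (a : arr (cone E)) : Fc (src a) :=
  match a with inl b => f b | inr e => bdry f (sval e) end.

(** [E] may be infinite; finiteness over the new arrows comes from the finite support of
    [bdry f]. *)
Fact cone_ext_fin f : finite_set [set a | cone_ext_at f a != 0].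
Proof.
have fin1 : finite_set (inl @` [set b | f b != 0] : set (arr (cone E))).
  by apply: finite_image; exact: dsum_fin.
have fin2 : finite_set [set e : {v | E v} | bdry f (sval e) != 0].
  apply: (finite_preimage (f := sval) (B := [set v | bdry f v != 0])).
    by move=> [u ?] [v ?] _ _ /= uv; exact: eq_exist.
  exact: dsum_fin.
have fin : finite_set ((inl @` [set b | f b != 0] : set (arr (cone E))) `|`
    inr @` [set e : {v | E v} | bdry f (sval e) != 0]).
  by rewrite finite_setU; split=> //; exact: finite_image.
by apply: sub_finite_set fin => -[b|e] /= h; [left; exists b | right; exists e].
Qed.
Definition cone_ext (f : chain1 F) : pchain Fc := DSum (cone_ext_fin f).

Lemma Phi_iso_ker : lmod_iso (Phi F E) (submod (ker (pbdry Fc))).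
Proof.
apply: (lmod_iso_of_inj_surj (f := ker_restr)) => [z|f].
  move=> /(congr1 (@submod_val _ _ _)) z0.
  have {}z0 : cone_restr (submod_val z) = 0 by [].
  have /kerP/pbdry_cone_eq0 dz := submod_in z.
  apply: val_inj; apply: dsumP => -[b|[e Ee]].
    by rewrite -[LHS]/(cone_restr (submod_val z) b) z0.
  (* The flow on the new arrow at [e] equals the boundary of the restriction, which is 0. *)
  have := dz e; rewrite z0 linear0 /cone_flow /= /cone_flow_fun.
  case: pselect => // Ee'; rewrite (Prop_irrelevance Ee' Ee).
  by move=> <-.
have restrK : cone_restr (cone_ext (submod_val f)) = submod_val f.
  exact: dsumP.
have zk : cone_ext (submod_val f) \in ker (pbdry Fc).
  apply/kerP/pbdry_cone_eq0 => v; rewrite restrK.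
  (* For [v] in [E] the equation holds by the choice of extension; off [E] the flow is 0 and the
     Kirchhoff law remains. *)
  rewrite /cone_flow /= /cone_flow_fun; case: pselect => // nEv.
  by have /asboolP := submod_in f; apply.
by exists (Submod zk); apply: val_inj.
Qed.
End ConeKernel.

Theorem theorem3p2 (R : pzRingType) (Gam : graph) (E : set (vert Gam))
    (F : representation R Gam) :
  lmod_iso (Phi F E) (colimn 1 (path_functor (cone_rep E F))).
Proof. exact: lmod_iso_trans (@Phi_iso_ker _ _ E F) (colim1_iso_ker _). Qed.
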